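(* Let $K$ be a field and let $R=\bigcup_{n\ge 0}R_n$ be a filtered $K$-algebra (with $K\subseteq R_0$) such that the associated graded algebra $\mathrm{gr}(R)$ is isomorphic to $K_q[X]$; fix such an isomorphism and regard it as an identification, so that $X\subseteq \mathrm{gr}(R)$. If $\sigma$ is an $X$-inner automorphism of $R$, then $\sigma$ preserves the filtration of $R$. Furthermore, if $x\in R$ is such that $\overline{x}\in X$, then $$x^\sigma=\alpha_x x+\text{terms of lower degree},$$ where $\alpha_x$ is a nonzero element of $K$; that is, $x^\sigma-\alpha_x x\in R_{d(x)-1}$.
   Context: Filtered $K$-algebra: $R=\bigcup_{n\ge0}R_n$ with $R_0\subseteq R_1\subseteq\cdots$ $K$-subspaces, $K\subseteq R_0$, $R_nR_m\subseteq R_{n+m}$; set $R_{-1}=0$. For nonzero $r\in R$, the degree $d(r)$ is the $m$ with $r\in R_m$, $r\notin R_{m-1}$. The associated graded algebra is $\mathrm{gr}(R)=\bigoplus_{n\ge0}R_n/R_{n-1}$, and if $d(r)=m$ then $\overline{r}$ denotes the element $r+R_{m-1}$ of $\mathrm{gr}(R)$. ''$\sigma$ preserves the filtration'' means $d(s^\sigma)=d(s)$ for all nonzero $s\in R$. The algebra $K_q[X]$: $X=\{x_i\mid i\in I\}$ is a set of variables ($I$ not necessarily finite), $(q_{ij})_{i,j\in I}$ are nonzero elements of $K$ with $q_{ii}=1$, $q_{ij}=q_{ji}^{-1}$, and $K_q[X]$ is the $K$-algebra generated by $X$ subject to $x_ix_j=q_{ij}x_jx_i$ for all $i,j\in I$.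 For a prime ring $R$, $Q(R)$ denotes its symmetric Martindale quotient ring (the set of elements $q$ of the left Martindale quotient ring of $R$ for which there is a nonzero two-sided ideal $J$ of $R$ with $Jq\subseteq R$ and $qJ\subseteq R$), and $N(R)$ denotes the set of those $w\in Q(R)$ with $wR=Rw$. An automorphism $\sigma$ of $R$ is called $X$-inner if there is a nonzero $w\in N(R)$ such that $r^\sigma w=wr$ for all $r\in R$. Here $r^\sigma$ denotes the image of $r$ under $\sigma$. (The ''$X$'' in ''$X$-inner'' is unrelated to the set $X$ of variables.) *)

(* Defs.v *)
From HB Require Import structures.
From mathcomp Require Import all_boot all_algebra.
From mathcomp Require Import boolp classical_sets.

Set Implicit Arguments.
Unset Strict Implicit.
Unset Printing Implicit Defensive.

Import GRing.Theory.

Local Open Scope classical_set_scope.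
Local Open Scope quotient_scope.
Local Open Scope ring_scope.

(* -------------------------------------------------------------------------- *)

Section QuantumSpace.
Variables (K : fieldType) (I : choiceType) (q : I -> I -> K).

(* Non-commutative polynomial expressions in the generators; scaling by c and
   the opposite are multiplication by [KqCst c] and [KqCst (-1)]. *)
Inductive kq_term : Type :=
  | KqVar of I
  | KqCst of K
  | KqAdd of kq_term & kq_term
  | KqMul of kq_term & kq_term.

(* The least congruence containing the K-algebra axioms and the relations
   x_i x_j = q_ij x_j x_i. *)
Inductive kq_eq : kq_term -> kq_term -> Prop :=
  | kq_refl t : kq_eq t t
  | kq_sym t u : kq_eq t u -> kq_eq u t
  | kq_trans t u v : kq_eq t u -> kq_eq u v -> kq_eq t v
  | kq_congD t t' u u' :
      kq_eq t t' -> kq_eq u u' -> kq_eq (KqAdd t u) (KqAdd t' u')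
  | kq_congM t t' u u' :
      kq_eq t t' -> kq_eq u u' -> kq_eq (KqMul t u) (KqMul t' u')
  | kq_addA t u v : kq_eq (KqAdd t (KqAdd u v)) (KqAdd (KqAdd t u) v)
  | kq_addC t u : kq_eq (KqAdd t u) (KqAdd u t)
  | kq_add0 t : kq_eq (KqAdd (KqCst 0) t) t
  | kq_addN t : kq_eq (KqAdd (KqMul (KqCst (-1)) t) t) (KqCst 0)
  | kq_mulA t u v : kq_eq (KqMul t (KqMul u v)) (KqMul (KqMul t u) v)
  | kq_mul1 t : kq_eq (KqMul (KqCst 1) t) t
  | kq_mulDl t u v : kq_eq (KqMul (KqAdd t u) v) (KqAdd (KqMul t v) (KqMul u v))
  | kq_mulDr t u v : kq_eq (KqMul t (KqAdd u v)) (KqAdd (KqMul t u) (KqMul t v))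
  | kq_cstD a b : kq_eq (KqCst (a + b)) (KqAdd (KqCst a) (KqCst b))
  | kq_cstM a b : kq_eq (KqCst (a * b)) (KqMul (KqCst a) (KqCst b))
  | kq_cstC a t : kq_eq (KqMul (KqCst a) t) (KqMul t (KqCst a))
  | kq_rel i j :
      kq_eq (KqMul (KqVar i) (KqVar j))
            (KqMul (KqCst (q i j)) (KqMul (KqVar j) (KqVar i))).

HB.instance Definition _ := gen_eqMixin kq_term.
HB.instance Definition _ := gen_choiceMixin kq_term.

Definition kq_eqb : rel kq_term := fun t u => `[< kq_eq t u >].

Fact kq_eqb_equiv : equiv_class_of kq_eqb.
Proof.
split=> [t|t u|u t v].
- by apply/asboolP; apply: kq_refl.
- by apply/asboolP/asboolP; apply: kq_sym.
- by move=> /asboolP tu /asboolP uv; apply/asboolP; apply: kq_trans tu uv.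
Qed.

Canonical kq_equiv := EquivRelPack kq_eqb_equiv.

Definition Kq : Type := {eq_quot kq_equiv}.
HB.instance Definition _ := Choice.on Kq.

Definition kq_pi (t : kq_term) : Kq := \pi_{eq_quot kq_equiv} t.
Definition kq_repr (u : Kq) : kq_term := repr (u : {eq_quot kq_equiv}).

Lemma kq_piP t u : kq_pi t = kq_pi u <-> kq_eq t u.
Proof.
split; first by move=> /eqmodP /asboolP.
by move=> tu; apply/eqmodP/asboolP.
Qed.

Lemma kq_reprK u : kq_pi (kq_repr u) = u.
Proof. exact: reprK. Qed.

Lemma kq_repr_pi t : kq_eq (kq_repr (kq_pi t)) t.
Proof. by apply/kq_piP; rewrite kq_reprK. Qed.

Lemma kq_ind (P : Kq -> Prop) : (forall t, P (kq_pi t)) -> forall u, P u.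
Proof. by move=> h u; rewrite -(kq_reprK u). Qed.

Definition kq_cst (c : K) : Kq := kq_pi (KqCst c).
Definition kq_add (u v : Kq) := kq_pi (KqAdd (kq_repr u) (kq_repr v)).
Definition kq_mul (u v : Kq) := kq_pi (KqMul (kq_repr u) (kq_repr v)).

Lemma kq_addE t u : kq_add (kq_pi t) (kq_pi u) = kq_pi (KqAdd t u).
Proof. by apply/kq_piP/kq_congD; apply: kq_repr_pi. Qed.
Lemma kq_mulE t u : kq_mul (kq_pi t) (kq_pi u) = kq_pi (KqMul t u).
Proof. by apply/kq_piP/kq_congM; apply: kq_repr_pi. Qed.

Fact kq_addrA : associative kq_add.
Proof.
elim/kq_ind=> t; elim/kq_ind=> u; elim/kq_ind=> v.
by rewrite !kq_addE; apply/kq_piP/kq_addA.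
Qed.
Fact kq_addrC : commutative kq_add.
Proof.
by elim/kq_ind=> t; elim/kq_ind=> u; rewrite !kq_addE; apply/kq_piP/kq_addC.
Qed.
Fact kq_add0r : left_id (kq_cst 0) kq_add.
Proof. by elim/kq_ind=> t; rewrite kq_addE; apply/kq_piP/kq_add0. Qed.
Fact kq_addNr : left_inverse (kq_cst 0) (kq_mul (kq_cst (-1))) kq_add.
Proof. by elim/kq_ind=> t; rewrite kq_mulE kq_addE; apply/kq_piP/kq_addN. Qed.
Fact kq_mulrA : associative kq_mul.
Proof.
elim/kq_ind=> t; elim/kq_ind=> u; elim/kq_ind=> v.
by rewrite !kq_mulE; apply/kq_piP/kq_mulA.
Qed.
Fact kq_mulcC c : forall u, kq_mul (kq_cst c) u = kq_mul u (kq_cst c).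
Proof. by elim/kq_ind=> t; rewrite !kq_mulE; apply/kq_piP/kq_cstC. Qed.
Fact kq_mul1r : left_id (kq_cst 1) kq_mul.
Proof. by elim/kq_ind=> t; rewrite kq_mulE; apply/kq_piP/kq_mul1. Qed.
Fact kq_mulr1 : right_id (kq_cst 1) kq_mul.
Proof. by move=> u; rewrite -kq_mulcC kq_mul1r. Qed.
Fact kq_mulrDl : left_distributive kq_mul kq_add.
Proof.
elim/kq_ind=> t; elim/kq_ind=> u; elim/kq_ind=> v.
by rewrite !(kq_addE, kq_mulE); apply/kq_piP/kq_mulDl.
Qed.
Fact kq_mulrDr : right_distributive kq_mul kq_add.
Proof.
elim/kq_ind=> t; elim/kq_ind=> u; elim/kq_ind=> v.
by rewrite !(kq_addE, kq_mulE); apply/kq_piP/kq_mulDr.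
Qed.

Fact kq_oner_neq0 : kq_cst 1 != kq_cst 0.
Proof.
pose ev := fix ev t : K := match t with
  | KqVar _ => 0 | KqCst c => c
  | KqAdd t u => ev t + ev u | KqMul t u => ev t * ev u end.
apply/eqP=> /kq_piP e.
suff /(_ _ _ e)/eqP : forall t u, kq_eq t u -> ev t = ev u by rewrite /= oner_eq0.
move=> t u; elim=> //= {t u e}.
- by move=> ? ? ? _ -> _ ->.
- by move=> ? ? ? ? _ -> _ ->.
- by move=> ? ? ? ? _ -> _ ->.
- by move=> *; rewrite addrA.
- by move=> *; rewrite addrC.
- by move=> *; rewrite add0r.
- by move=> *; rewrite mulN1r addNr.
- by move=> *; rewrite mulrA.
- by move=> *; rewrite mul1r.
- by move=> *; rewrite mulrDl.
- by move=> *; rewrite mulrDr.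
- by move=> *; rewrite mulrC.
- by move=> *; rewrite !mulr0.
Qed.

HB.instance Definition _ := GRing.isNzRing.Build Kq
  kq_addrA kq_addrC kq_add0r kq_addNr kq_mulrA kq_mul1r kq_mulr1
  kq_mulrDl kq_mulrDr kq_oner_neq0.

Definition kq_scale (c : K) (u : Kq) : Kq := kq_cst c * u.

Fact kq_scaleA a b u : kq_scale a (kq_scale b u) = kq_scale (a * b) u.
Proof.
rewrite /kq_scale mulrA; congr (_ * _).
by rewrite [LHS]kq_mulE; apply/kq_piP/kq_sym/kq_cstM.
Qed.
Fact kq_scale1 : left_id 1 kq_scale.
Proof. by move=> u; apply: mul1r. Qed.
Fact kq_scaleDr : right_distributive kq_scale +%R.
Proof. by move=> a u v; apply: mulrDr. Qed.
Fact kq_scaleDl u : {morph kq_scale^~ u : a b / a + b}.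
Proof.
move=> a b; rewrite /kq_scale -mulrDl; congr (_ * _).
by rewrite [RHS]kq_addE; apply/kq_piP/kq_cstD.
Qed.

HB.instance Definition _ := GRing.Zmodule_isLmodule.Build K Kq
  kq_scaleA kq_scale1 kq_scaleDr kq_scaleDl.

Fact kq_scalerAl (a : K) (u v : Kq) : a *: (u * v) = (a *: u) * v.
Proof. exact: mulrA. Qed.
HB.instance Definition _ := GRing.Lmodule_isLalgebra.Build K Kq kq_scalerAl.

Fact kq_scalerAr (a : K) (u v : Kq) : a *: (u * v) = u * (a *: v).
Proof.
rewrite kq_scalerAl; have -> : a *: u = u * kq_cst a by apply: kq_mulcC.
by rewrite -[LHS]mulrA.
Qed.
HB.instance Definition _ := GRing.Lalgebra_isAlgebra.Build K Kq kq_scalerAr.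

Definition kq_var (i : I) : Kq := kq_pi (KqVar i).

End QuantumSpace.

(* -------------------------------------------------------------------------- *)

Record filtration (K : fieldType) (R : algType K) := Filtration {
  fil :> nat -> set R;
  fil0 : forall n, fil n 0;
  filL : forall n (a : K) (x y : R), fil n x -> fil n y -> fil n (a *: x + y);
  filS : forall n, fil n `<=` fil n.+1;
  filK : forall k : K, fil 0 k%:A;
  filM : forall n m (x y : R), fil n x -> fil m y -> fil (n + m)%N (x * y);
  filU : forall x : R, exists n, fil n x }.

Section AssociatedGraded.
Variables (K : fieldType) (R : algType K) (F : filtration R).

(* R_(n-1), with the convention R_(-1) = 0. *)
Definition fil_pred (n : nat) : set R := if n is m.+1 then F m else [set 0].

Fact degree_subproof (r : R) : exists n, `[< F n r >].
Proof. by have [n Fnr] := filU F r; exists n; apply/asboolP. Qed.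

(* The least n with r in R_n; hence 0 when r = 0. *)
Definition degree (r : R) : nat := ex_minn (degree_subproof r).

Lemma degreeP r : F (degree r) r.
Proof. by rewrite /degree; case: ex_minnP => n /asboolP. Qed.

Lemma filD n x y : F n x -> F n y -> F n (x + y).
Proof. by move=> Fx Fy; rewrite -[x]scale1r; apply: filL. Qed.

Lemma filN n x : F n x -> F n (- x).
Proof.
by move=> Fx; rewrite -scaleN1r -[_ *: x]addr0; apply: filL => //; apply: fil0.
Qed.

Lemma fil_sum n (J : Type) (s : seq J) (P : pred J) (f : J -> R) :
  (forall j, P j -> F n (f j)) -> F n (\sum_(j <- s | P j) f j).
Proof. by move=> Ff; elim/big_ind: _ => //; [exact: fil0|exact: filD]. Qed.

Lemma fil_pred0 n : fil_pred n 0.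
Proof. by case: n => //= n; apply: fil0. Qed.

Lemma fil_predD n x y : fil_pred n x -> fil_pred n y -> fil_pred n (x + y).
Proof. by case: n => [-> ->|n]; [rewrite /= addr0|apply: filD]. Qed.

Lemma fil_predN n x : fil_pred n x -> fil_pred n (- x).
Proof. by case: n => [->|n]; [rewrite /= oppr0|apply: filN]. Qed.

Lemma fil_predMl n m x y : fil_pred n x -> F m y -> fil_pred (n + m)%N (x * y).
Proof.
case: n => [/= -> _|n]; first by rewrite mul0r; apply: fil_pred0.
exact: filM.
Qed.

Lemma fil_predMr n m x y : F n x -> fil_pred m y -> fil_pred (n + m)%N (x * y).
Proof.
case: m => [/= _ ->|m]; first by rewrite mulr0; apply: fil_pred0.
by rewrite addnS; apply: filM.
Qed.

Lemma fil_pred_sum n (J : Type) (s : seq J) (P : pred J) (f : J -> R) :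
  (forall j, P j -> fil_pred n (f j)) -> fil_pred n (\sum_(j <- s | P j) f j).
Proof.
by move=> Ff; elim/big_ind: _ => //; [exact: fil_pred0|exact: fil_predD].
Qed.

(* The direct sum of the R_n, as the ring of polynomials sum_n r_n 'X^n in a
   central indeterminate with r_n in R_n. *)
Definition rees_pred : pred {poly R} := fun p => `[< forall n, F n p`_n >].

Record rees := Rees { rees_val :> {poly R}; _ : rees_pred rees_val }.
HB.instance Definition _ := [isSub for rees_val].
HB.instance Definition _ := [Choice of rees by <:].

Lemma reesP (p : rees) n : F n (rees_val p)`_n.
Proof. by case: p => p /= /asboolP. Qed.

Fact rees_subring : subring_closed rees_pred.
Proof.
split=> [|p r|p r].
- apply/asboolP=> -[|n]; rewrite coef1 /=; last exact: fil0.
  by rewrite -[X in F _ X]scale1r; apply: filK.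
- move=> /asboolP Fp /asboolP Fr; apply/asboolP=> n.
  by rewrite coefB; apply: filD => //; apply: filN.
- move=> /asboolP Fp /asboolP Fr; apply/asboolP=> n.
  rewrite coefM; apply: fil_sum => i _.
  by rewrite -[n in F n _](subnKC (leq_ord i)); apply: filM.
Qed.
HB.instance Definition _ :=
  GRing.SubChoice_isSubNzRing.Build {poly R} rees_pred rees rees_subring.

(* gr(R) is the quotient by the ideal of the sum_n r_n 'X^n with r_n in R_(n-1),
   so that its component of degree n is R_n / R_(n-1). *)
Definition gr_eq : rel rees :=
  fun p r => `[< forall n, fil_pred n ((rees_val p)`_n - (rees_val r)`_n) >].

Fact gr_eq_equiv : equiv_class_of gr_eq.
Proof.
split=> [p|p r|r p s].
- by apply/asboolP=> n; rewrite subrr; apply: fil_pred0.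
- by apply/asboolP/asboolP=> h n; rewrite -opprB; apply: fil_predN.
- move=> /asboolP pr /asboolP rs; apply/asboolP=> n.
  by have := fil_predD (pr n) (rs n); rewrite addrA subrK.
Qed.

Canonical gr_equiv := EquivRelPack gr_eq_equiv.

Definition gr : Type := {eq_quot gr_equiv}.
HB.instance Definition _ := Choice.on gr.

Definition gr_pi (p : rees) : gr := \pi_{eq_quot gr_equiv} p.
Definition gr_repr (u : gr) : rees := repr (u : {eq_quot gr_equiv}).

Lemma gr_piP (p r : rees) :
  gr_pi p = gr_pi r <->
  forall n, fil_pred n ((rees_val p)`_n - (rees_val r)`_n).
Proof.
split; first by move=> /eqmodP /asboolP.
by move=> pr; apply/eqmodP/asboolP.
Qed.

Lemma gr_reprK u : gr_pi (gr_repr u) = u.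
Proof. exact: reprK. Qed.

Lemma gr_repr_pi p n :
  fil_pred n ((rees_val (gr_repr (gr_pi p)))`_n - (rees_val p)`_n).
Proof. by move: n; apply/gr_piP; rewrite gr_reprK. Qed.

Lemma gr_ind (P : gr -> Prop) : (forall p, P (gr_pi p)) -> forall u, P u.
Proof. by move=> h u; rewrite -(gr_reprK u). Qed.

Definition gr_add (u v : gr) := gr_pi (gr_repr u + gr_repr v).
Definition gr_opp (u : gr) := gr_pi (- gr_repr u).
Definition gr_mul (u v : gr) := gr_pi (gr_repr u * gr_repr v).

Lemma gr_addE p r : gr_add (gr_pi p) (gr_pi r) = gr_pi (p + r).
Proof.
apply/gr_piP=> n; rewrite /= !coefD opprD addrACA.
by apply: fil_predD; apply: gr_repr_pi.
Qed.

Lemma gr_oppE p : gr_opp (gr_pi p) = gr_pi (- p).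
Proof.
apply/gr_piP=> n; rewrite /= !coefN -opprD.
by apply: fil_predN; apply: gr_repr_pi.
Qed.

Lemma gr_mulE p r : gr_mul (gr_pi p) (gr_pi r) = gr_pi (p * r).
Proof.
apply/gr_piP=> n; rewrite /= !coefM -sumrB; apply: fil_pred_sum => i _.
rewrite -[n in fil_pred n _](subnKC (leq_ord i)).
set p' := gr_repr _; set r' := gr_repr _.
have -> (a a' b b' : R) : a' * b' - a * b = (a' - a) * b' + a * (b' - b).
  by rewrite mulrBl mulrBr addrA subrK.
by apply: fil_predD; [apply: fil_predMl|apply: fil_predMr];
  try exact: reesP; apply: gr_repr_pi.
Qed.

Fact gr_addrA : associative gr_add.
Proof.
elim/gr_ind=> p; elim/gr_ind=> r; elim/gr_ind=> s.
by rewrite !gr_addE addrA.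
Qed.
Fact gr_addrC : commutative gr_add.
Proof. by elim/gr_ind=> p; elim/gr_ind=> r; rewrite !gr_addE addrC. Qed.
Fact gr_add0r : left_id (gr_pi 0) gr_add.
Proof. by elim/gr_ind=> p; rewrite !gr_addE add0r. Qed.
Fact gr_addNr : left_inverse (gr_pi 0) gr_opp gr_add.
Proof. by elim/gr_ind=> p; rewrite gr_oppE !gr_addE addNr. Qed.
Fact gr_mulrA : associative gr_mul.
Proof.
elim/gr_ind=> p; elim/gr_ind=> r; elim/gr_ind=> s.
by rewrite !gr_mulE mulrA.
Qed.
Fact gr_mul1r : left_id (gr_pi 1) gr_mul.
Proof. by elim/gr_ind=> p; rewrite !gr_mulE mul1r. Qed.
Fact gr_mulr1 : right_id (gr_pi 1) gr_mul.
Proof. by elim/gr_ind=> p; rewrite !gr_mulE mulr1. Qed.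
Fact gr_mulrDl : left_distributive gr_mul gr_add.
Proof.
elim/gr_ind=> p; elim/gr_ind=> r; elim/gr_ind=> s.
by rewrite !(gr_addE, gr_mulE) mulrDl.
Qed.
Fact gr_mulrDr : right_distributive gr_mul gr_add.
Proof.
elim/gr_ind=> p; elim/gr_ind=> r; elim/gr_ind=> s.
by rewrite !(gr_addE, gr_mulE) mulrDr.
Qed.
Fact gr_oner_neq0 : gr_pi 1 != gr_pi 0.
Proof.
apply/eqP=> /gr_piP /(_ 0%N) /=.
by rewrite coef1 coef0 subr0 => /eqP; rewrite oner_eq0.
Qed.

HB.instance Definition _ := GRing.isNzRing.Build gr
  gr_addrA gr_addrC gr_add0r gr_addNr gr_mulrA gr_mul1r gr_mulr1
  gr_mulrDl gr_mulrDr gr_oner_neq0.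

Fact rees_cst_subproof (k : K) : rees_pred (k%:A%:P).
Proof.
apply/asboolP=> -[|n]; rewrite coefC /=; [exact: filK|exact: fil0].
Qed.
Definition rees_cst (k : K) : rees := Rees (rees_cst_subproof k).

Definition gr_scale (k : K) (u : gr) : gr := gr_pi (rees_cst k) * u.

Fact gr_scaleA a b u : gr_scale a (gr_scale b u) = gr_scale (a * b) u.
Proof.
rewrite /gr_scale mulrA; congr (_ * _).
rewrite [LHS]gr_mulE; congr gr_pi; apply: val_inj => /=.
by rewrite -polyCM -scalerAl mul1r scalerA.
Qed.
Fact gr_scale1 : left_id 1 gr_scale.
Proof.
move=> u; rewrite -[RHS]mul1r; congr (_ * _).
by congr gr_pi; apply: val_inj => /=; rewrite scale1r.
Qed.
Fact gr_scaleDr : right_distributive gr_scale +%R.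
Proof. by move=> a u v; apply: mulrDr. Qed.
Fact gr_scaleDl u : {morph gr_scale^~ u : a b / a + b}.
Proof.
move=> a b; rewrite /gr_scale -mulrDl; congr (_ * _).
rewrite [RHS]gr_addE; congr gr_pi; apply: val_inj => /=.
by rewrite -polyCD scalerDl.
Qed.

HB.instance Definition _ := GRing.Zmodule_isLmodule.Build K gr
  gr_scaleA gr_scale1 gr_scaleDr gr_scaleDl.

Fact gr_scalerAl (a : K) (u v : gr) : a *: (u * v) = (a *: u) * v.
Proof. exact: mulrA. Qed.
HB.instance Definition _ := GRing.Lmodule_isLalgebra.Build K gr gr_scalerAl.

Fact gr_scalerAr (a : K) (u v : gr) : a *: (u * v) = u * (a *: v).
Proof.
rewrite gr_scalerAl.
suff -> : a *: u = u * gr_pi (rees_cst a) by rewrite -[LHS]mulrA.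
elim/gr_ind: u => p; rewrite [LHS]gr_mulE [RHS]gr_mulE.
congr gr_pi; apply: val_inj; apply/polyP=> n /=.
by rewrite coefCM coefMC -scalerAl mul1r -scalerAr mulr1.
Qed.
HB.instance Definition _ := GRing.Lalgebra_isAlgebra.Build K gr gr_scalerAr.

Fact rees_mono_subproof (r : R) : rees_pred (r *: 'X^(degree r)).
Proof.
apply/asboolP=> n; rewrite coefZ coefXn.
by case: eqP => [->|_]; rewrite (mulr1, mulr0); [exact: degreeP|exact: fil0].
Qed.

(* The element r + R_(m-1) of degree m := d(r) (meaningful for r != 0). *)
Definition gr_symbol (r : R) : gr := gr_pi (Rees (rees_mono_subproof r)).

Definition preserves_filtration (s : R -> R) : Prop :=
  forall r : R, r != 0 -> degree (s r) = degree r.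

End AssociatedGraded.

(* -------------------------------------------------------------------------- *)

Record two_sided_ideal (R : pzRingType) (J : set R) : Prop := TwoSidedIdeal {
  ideal0 : J 0;
  idealD : forall x y, J x -> J y -> J (x + y);
  idealMl : forall r x, J x -> J (r * x);
  idealMr : forall r x, J x -> J (x * r) }.

Definition nonzero_ideal (R : pzRingType) (J : set R) : Prop :=
  two_sided_ideal J /\ exists2 x, J x & x <> 0.

Definition prime_ring (R : pzRingType) : Prop :=
  (1 : R) <> 0 /\
  forall A B : set R, nonzero_ideal A -> nonzero_ideal B ->
    exists a b, [/\ A a, B b & a * b <> 0].

Section Martindale.
Variable R : pzRingType.

(* A left R-module homomorphism f : J -> R from a nonzero two-sided ideal J;
   the values of [mfun] outside [mdom] are irrelevant. *)
Record mhom := Mhom {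
  mdom : set R;
  mfun : R -> R;
  mdomP : nonzero_ideal mdom;
  mfunD : forall x y, mdom x -> mdom y -> mfun (x + y) = mfun x + mfun y;
  mfunM : forall r x, mdom x -> mfun (r * x) = r * mfun x }.

HB.instance Definition _ := gen_eqMixin mhom.
HB.instance Definition _ := gen_choiceMixin mhom.

Definition mhom_agree (f g : mhom) : Prop :=
  exists J : set R, [/\ nonzero_ideal J, J `<=` mdom f, J `<=` mdom g &
    forall x, J x -> mfun f x = mfun g x].

Hypothesis primeR : prime_ring R.

Lemma nonzero_idealI (A B : set R) :
  nonzero_ideal A -> nonzero_ideal B -> nonzero_ideal (A `&` B).
Proof.
move=> nA nB; have [a [b [Aa Bb ab]]] := primeR.2 _ _ nA nB.
case: nA nB => [iA _] [iB _]; split.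
  split.
  - by split; [exact: ideal0 iA|exact: ideal0 iB].
  - by move=> x y [? ?] [? ?]; split; [exact: (idealD iA)|exact: (idealD iB)].
  - by move=> r x [? ?]; split; [exact: (idealMl iA)|exact: (idealMl iB)].
  - by move=> r x [? ?]; split; [exact: (idealMr iA)|exact: (idealMr iB)].
by exists (a * b) => //; split; [exact: (idealMr iA)|exact: (idealMl iB)].
Qed.

Lemma nonzero_idealT : nonzero_ideal [set: R].
Proof. by split=> //; exists 1 => //; exact: primeR.1. Qed.

Definition mhom_agreeb : rel mhom := fun f g => `[< mhom_agree f g >].

Fact mhom_agreeb_equiv : equiv_class_of mhom_agreeb.
Proof.
split=> [f|f g|g f h].
- by apply/asboolP; exists (mdom f); split=> //; exact: mdomP.
- by apply/asboolP/asboolP=> -[J [nJ Jf Jg e]]; exists J; split=> // x /e.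
- move=> /asboolP[J [nJ Jf Jg e]] /asboolP[L [nL Lg Lh e']].
  apply/asboolP; exists (J `&` L); split.
  + exact: nonzero_idealI.
  + by move=> x [/Jf].
  + by move=> x [_ /Lh].
  + by move=> x [/e -> /e'].
Qed.

Canonical mhom_equiv := EquivRelPack mhom_agreeb_equiv.

(* The left Martindale quotient ring lim_J Hom_R(J, R), J running over the
   nonzero two-sided ideals.  Homomorphisms act on the right, as x |-> x q, so
   that the product f g is "first f, then g" and r : R is right
   multiplication by r. *)
Definition martindale : Type := {eq_quot mhom_equiv}.
HB.instance Definition _ := Choice.on martindale.

Definition mart_pi (f : mhom) : martindale := \pi_{eq_quot mhom_equiv} f.
Definition mart_repr (u : martindale) : mhom := repr (u : {eq_quot mhom_equiv}).

Lemma mart_piP f g : mart_pi f = mart_pi g <-> mhom_agree f g.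
Proof.
split; first by move=> /eqmodP /asboolP.
by move=> fg; apply/eqmodP/asboolP.
Qed.

Lemma mart_reprK u : mart_pi (mart_repr u) = u.
Proof. exact: reprK. Qed.

Lemma mart_repr_pi f : mhom_agree (mart_repr (mart_pi f)) f.
Proof. by apply/mart_piP; rewrite mart_reprK. Qed.

Lemma mart_ind (P : martindale -> Prop) :
  (forall f, P (mart_pi f)) -> forall u, P u.
Proof. by move=> h u; rewrite -(mart_reprK u). Qed.

#[local] Obligation Tactic := idtac.

Program Definition mhom_of (r : R) : mhom :=
  @Mhom setT (fun x => x * r) nonzero_idealT _ _.
Next Obligation. by move=> * /=; rewrite mulrDl. Qed.
Next Obligation. by move=> * /=; rewrite mulrA. Qed.

Program Definition mhom_add (f g : mhom) : mhom :=
  @Mhom (mdom f `&` mdom g) (fun x => mfun f x + mfun g x)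
    (nonzero_idealI (mdomP f) (mdomP g)) _ _.
Next Obligation. by move=> f g x y [? ?] [? ?] /=; rewrite !mfunD // addrACA. Qed.
Next Obligation. by move=> f g r x [? ?] /=; rewrite !mfunM // mulrDr. Qed.

Program Definition mhom_opp (f : mhom) : mhom :=
  @Mhom (mdom f) (fun x => - mfun f x) (mdomP f) _ _.
Next Obligation. by move=> f x y ? ? /=; rewrite mfunD // opprD. Qed.
Next Obligation. by move=> f r x ? /=; rewrite mfunM // mulrN. Qed.

(* The largest two-sided ideal on which x |-> g (f x) is defined; it contains
   the product of the ideals [mdom g] and [mdom f]. *)
Definition mcomp_dom (f g : mhom) : set R :=
  [set x | forall r, mdom f (x * r) /\ mdom g (mfun f (x * r))].

Lemma mcomp_domP f g : nonzero_ideal (mcomp_dom f g).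
Proof.
have [iF _] := mdomP f; have [iG _] := mdomP g.
split.
  split.
  - move=> r; rewrite mul0r; split; first exact: ideal0 iF.
    by rewrite -(mul0r 0) mfunM ?mul0r; [exact: ideal0 iG|exact: ideal0 iF].
  - move=> x y Dx Dy r; have [? ?] := Dx r; have [? ?] := Dy r.
    by rewrite mulrDl mfunD //; split; [exact: (idealD iF)|exact: (idealD iG)].
  - move=> s x Dx r; have [? ?] := Dx r.
    by rewrite -mulrA mfunM //; split; [exact: (idealMl iF)|exact: (idealMl iG)].
  - by move=> s x Dx r; rewrite -mulrA; apply: Dx.
have [b [a [Gb Fa ba]]] := primeR.2 _ _ (mdomP g) (mdomP f).
exists (b * a) => // r; rewrite -mulrA.
have Far : mdom f (a * r) by apply: (idealMr iF).
by rewrite mfunM //; split; [exact: (idealMl iF)|exact: (idealMr iG)].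
Qed.

Lemma mcomp_dom1 f g x : mcomp_dom f g x -> mdom f x /\ mdom g (mfun f x).
Proof. by move=> /(_ 1); rewrite mulr1. Qed.

Program Definition mhom_mul (f g : mhom) : mhom :=
  @Mhom (mcomp_dom f g) (fun x => mfun g (mfun f x)) (mcomp_domP f g) _ _.
Next Obligation.
by move=> f g x y /mcomp_dom1[? ?] /mcomp_dom1[? ?] /=; rewrite !mfunD //.
Qed.
Next Obligation. by move=> f g r x /mcomp_dom1[? ?] /=; rewrite !mfunM //. Qed.

Lemma mhom_agreeI f g :
  (forall x, mdom f x -> mdom g x -> mfun f x = mfun g x) -> mhom_agree f g.
Proof.
move=> e; exists (mdom f `&` mdom g); split; last by move=> x [fx gx]; apply: e.
- by apply: nonzero_idealI; apply: mdomP.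
- by move=> x [].
- by move=> x [].
Qed.

Definition mart_of (r : R) : martindale := mart_pi (mhom_of r).
Definition mart_add (u v : martindale) :=
  mart_pi (mhom_add (mart_repr u) (mart_repr v)).
Definition mart_opp (u : martindale) := mart_pi (mhom_opp (mart_repr u)).
Definition mart_mul (u v : martindale) :=
  mart_pi (mhom_mul (mart_repr u) (mart_repr v)).

Lemma mart_addE f g : mart_add (mart_pi f) (mart_pi g) = mart_pi (mhom_add f g).
Proof.
apply/mart_piP.
have [J [nJ Jf Jf' e]] := mart_repr_pi f.
have [L [nL Lg Lg' e']] := mart_repr_pi g.
exists (J `&` L); split; first exact: nonzero_idealI.
- by move=> x [/Jf ? /Lg].
- by move=> x [/Jf' ? /Lg'].
- by move=> x [/e + /e'] /= => -> ->.
Qed.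

Lemma mart_oppE f : mart_opp (mart_pi f) = mart_pi (mhom_opp f).
Proof.
apply/mart_piP; have [J [nJ Jf Jf' e]] := mart_repr_pi f.
by exists J; split=> // x /e /= ->.
Qed.

Lemma mart_mulE f g : mart_mul (mart_pi f) (mart_pi g) = mart_pi (mhom_mul f g).
Proof.
apply/mart_piP.
have [J [nJ Jf Jf' e]] := mart_repr_pi f.
have [L [nL Lg Lg' e']] := mart_repr_pi g.
set f' := mart_repr _ in Jf e *; set g' := mart_repr _ in Lg e' *.
pose h := Mhom nJ (fun x y Jx Jy => mfunD (Jf' x Jx) (Jf' y Jy))
               (fun r x Jx => mfunM r (Jf' x Jx)).
pose k := Mhom nL (fun x y Lx Ly => mfunD (Lg' x Lx) (Lg' y Ly))
               (fun r x Lx => mfunM r (Lg' x Lx)).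
exists (mcomp_dom h k); split.
- exact: mcomp_domP.
- move=> x D r; have /= [Jx Lx] := D r.
  by split; [exact: Jf|rewrite e //; exact: Lg].
- move=> x D r; have /= [Jx Lx] := D r.
  by split; [exact: (Jf' _ Jx)|exact: (Lg' _ Lx)].
- by move=> x /mcomp_dom1 /= [Jx Lx]; rewrite e // e'.
Qed.

Fact mart_addrA : associative mart_add.
Proof.
elim/mart_ind=> f; elim/mart_ind=> g; elim/mart_ind=> h.
rewrite !mart_addE; apply/mart_piP/mhom_agreeI => x _ _ /=.
by rewrite addrA.
Qed.
Fact mart_addrC : commutative mart_add.
Proof.
elim/mart_ind=> f; elim/mart_ind=> g.
by rewrite !mart_addE; apply/mart_piP/mhom_agreeI => x _ _ /=; rewrite addrC.
Qed.
Fact mart_add0r : left_id (mart_of 0) mart_add.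
Proof.
elim/mart_ind=> f; rewrite mart_addE.
by apply/mart_piP/mhom_agreeI => x _ _ /=; rewrite mulr0 add0r.
Qed.
Fact mart_addNr : left_inverse (mart_of 0) mart_opp mart_add.
Proof.
elim/mart_ind=> f; rewrite mart_oppE mart_addE.
by apply/mart_piP/mhom_agreeI => x _ _ /=; rewrite mulr0 addNr.
Qed.
Fact mart_mulrA : associative mart_mul.
Proof.
elim/mart_ind=> f; elim/mart_ind=> g; elim/mart_ind=> h.
by rewrite !mart_mulE; apply/mart_piP/mhom_agreeI.
Qed.
Fact mart_mul1r : left_id (mart_of 1) mart_mul.
Proof.
elim/mart_ind=> f; rewrite mart_mulE.
by apply/mart_piP/mhom_agreeI => x _ _ /=; rewrite mulr1.
Qed.
Fact mart_mulr1 : right_id (mart_of 1) mart_mul.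
Proof.
elim/mart_ind=> f; rewrite mart_mulE.
by apply/mart_piP/mhom_agreeI => x _ _ /=; rewrite mulr1.
Qed.
Fact mart_mulrDl : left_distributive mart_mul mart_add.
Proof.
elim/mart_ind=> f; elim/mart_ind=> g; elim/mart_ind=> h.
rewrite !(mart_addE, mart_mulE); apply/mart_piP/mhom_agreeI => x _ /=.
by move=> [/mcomp_dom1[? ?] /mcomp_dom1[? ?]]; rewrite mfunD.
Qed.
Fact mart_mulrDr : right_distributive mart_mul mart_add.
Proof.
elim/mart_ind=> f; elim/mart_ind=> g; elim/mart_ind=> h.
by rewrite !(mart_addE, mart_mulE); apply/mart_piP/mhom_agreeI.
Qed.

HB.instance Definition _ := GRing.isPzRing.Build martindale
  mart_addrA mart_addrC mart_add0r mart_addNr mart_mulrA mart_mul1r mart_mulr1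
  mart_mulrDl mart_mulrDr.

Fact mart_of_zmod : zmod_morphism mart_of.
Proof.
move=> r s; rewrite [- mart_of s]mart_oppE [RHS]mart_addE.
by apply/mart_piP/mhom_agreeI => x _ _ /=; rewrite mulrBr.
Qed.
HB.instance Definition _ :=
  GRing.isZmodMorphism.Build R martindale mart_of mart_of_zmod.

Fact mart_of_monoid : monoid_morphism mart_of.
Proof.
split=> // r s; rewrite [RHS]mart_mulE.
by apply/mart_piP/mhom_agreeI => x _ _ /=; rewrite mulrA.
Qed.
HB.instance Definition _ :=
  GRing.isMonoidMorphism.Build R martindale mart_of mart_of_monoid.

Lemma mart_of_inj : injective mart_of.
Proof.
move=> r s /mart_piP[J [nJ _ _ e]].
apply/eqP; rewrite -subr_eq0; apply/eqP; apply: contrapT => rs0.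
pose A := [set y | forall x t, J x -> x * t * y = 0].
have nA : nonzero_ideal A.
  split; last first.
    exists (r - s) => // x t Jx.
    have := e (x * t) (idealMr nJ.1 t Jx) => /= ext.
    by rewrite mulrBr ext subrr.
  split.
  - by move=> x t _; rewrite mulr0.
  - by move=> y z Ay Az x t Jx; rewrite mulrDr Ay // Az // addr0.
  - by move=> u y Ay x t Jx; rewrite mulrA -[x * t * u]mulrA Ay.
  - by move=> u y Ay x t Jx; rewrite mulrA Ay // mul0r.
have [x [y [Jx Ay]]] := primeR.2 _ _ nJ nA; apply.
by have := Ay x 1 Jx; rewrite mulr1.
Qed.

(* For f : J -> R and x in J, the product x f in the quotient ring is f(x). *)
Lemma mart_ofM f x : mdom f x -> mart_of x * mart_pi f = mart_of (mfun f x).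
Proof.
by move=> fx; rewrite [LHS]mart_mulE; apply/mart_piP/mhom_agreeI => r _ _ /=;
  rewrite mfunM.
Qed.

Definition sym_martindale : set martindale :=
  [set w | exists J : set R, [/\ nonzero_ideal J,
     (forall x, J x -> exists r, mart_of x * w = mart_of r) &
     (forall x, J x -> exists r, w * mart_of x = mart_of r)]].

Definition martindale_normal : set martindale :=
  [set w | sym_martindale w /\
     [set w * mart_of r | r in [set: R]] = [set mart_of r * w | r in [set: R]]].

Definition X_inner (s : R -> R) : Prop :=
  exists w : martindale, [/\ martindale_normal w, w != 0 &
    forall r : R, mart_of (s r) * w = w * mart_of r].

End Martindale.

(* Main.v *)
Require Import Defs.
From mathcomp Require Import all_boot all_algebra.
From mathcomp Require Import boolp classical_sets wochoice.
From mathcomp Require Import zify.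

(** Let [sigma] be X-inner, given by [w], and let [J] be a nonzero ideal with
    [J w] and [w J] inside [R].  Choosing [a] and [c] in [J] and putting
    [b := a w], [d := w c], the relation [sigma r * w = w * r] becomes an
    identity inside [R] itself ([X_inner_twist]):

      [b * r * c = a * sigma r * d]  for all [r], with [a, b, c, d] nonzero.

    The quantum space is a domain (see below), hence so is [gr F]; therefore
    degrees add and symbols multiply in [R], and [R] is a domain, in particular
    prime.  Comparing degrees in the identity at [r] and at [1] gives
    [degree (sigma r) = degree r].  Comparing symbols gives, in the quantum
    space, [b c = a d] and [b x_i c = a y d], where [y] is the symbol of
    [sigma x] and [x_i] that of [x].  It remains to see that such a [y] is a
    scalar multiple of [x_i] ([kq_var_twist]).

    For this, order the monomials by a total order compatible with products.
    Leading monomials multiply, up to permutation of the letters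
    ([leading_mul]), so the two equations force the leading monomial of [y] to
    be [x_i].  The same holds for the reversed order, i.e. for the trailing
    monomial, so [x_i] is the only monomial of [y].  Working with
    both orders, instead of with homogeneous components, allows for isomorphisms
    with the quantum space that do not respect the gradings.

    Both steps rest on the linear independence of the ordered monomials, the
    one place where consistency of the relations is used.  It is obtained by
    letting the quantum space act on functions on multisets of variables
    ([ev_eq]), which yields coefficient functionals ([mcoef]). *)

Import GRing.Theory.

Local Open Scope ring_scope.

Set Implicit Arguments.
Unset Strict Implicit.
Unset Printing Implicit Defensive.

(** * Orders on commutative words *)

Section WordOrder.
Variable I : choiceType.
Implicit Types (i j : I) (r s t u v : seq I).

(** The order axioms for monomials in commuting variables.  A monomial is
    represented by a word, and words that are permutations of each other are
    identified: trichotomy is only up to [perm_eq]. *)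
Record word_order (lt : rel (seq I)) : Prop := WordOrder {
  wlt_trans : transitive lt;
  wlt_nperm : forall s t, lt s t -> ~~ perm_eq s t;
  wlt_total : forall s t, ~~ perm_eq s t -> lt s t \/ lt t s;
  wlt_perm : forall s s' t t',
    perm_eq s s' -> perm_eq t t' -> lt s t -> lt s' t';
  wlt_cat2l : forall u s t, lt s t -> lt (u ++ s) (u ++ t) }.

(** Reversing the order turns leading monomials into trailing ones. *)
Lemma word_order_flip lt : word_order lt -> word_order (fun s t => lt t s).
Proof.
move=> [tr np tot pm ct]; split=> [s t u ts su|s t ts|s t st|s s' t t' ss tt|u s t].
- exact: tr su ts.
- by rewrite perm_sym np.
- by case: (tot _ _ st); [right|left].
- exact: pm.
- exact: ct.
Qed.

Lemma wlt_cat2r lt u s t : word_order lt -> lt s t -> lt (s ++ u) (t ++ u).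
Proof.
move=> wo /(wlt_cat2l wo u); apply: (wlt_perm wo); exact: permEl (perm_catC _ _).
Qed.

Lemma word_max lt s (l : seq (seq I)) : word_order lt ->
  exists2 m, m \in s :: l & forall t, t \in s :: l -> lt t m \/ perm_eq t m.
Proof.
move=> wo; elim: l s => [|r l IHl] s.
  by exists s; rewrite ?mem_head // => t; rewrite inE => /eqP->; right.
have [m ml maxm] := IHl r.
have [sm|nsm] := boolP (perm_eq s m).
  exists m; first by rewrite inE ml orbT.
  by move=> t; rewrite inE => /predU1P[->|/maxm//]; right.
have [sm|ms] := wlt_total wo nsm.
  exists m; first by rewrite inE ml orbT.
  by move=> t; rewrite inE => /predU1P[->|/maxm//]; left.
exists s; first exact: mem_head.
move=> t; rewrite inE => /predU1P[->|/maxm [tm|tm]]; first by right.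
  by left; apply: (wlt_trans wo) tm ms.
by left; apply: (wlt_perm wo) ms => //; rewrite perm_sym.
Qed.

End WordOrder.

Section Lexicographic.
Variable I : choiceType.
Implicit Types (i j k : I) (r s t u v : seq I).

(** The set of variables is arbitrary, so an order on it must come from the
    well-ordering principle.  Having least elements makes the lexicographic
    order total, since two different words then have a first variable on which
    their exponents differ. *)
Record strict_well_order (ltI : rel I) : Prop := StrictWellOrder {
  swo_asym : forall i j, ltI i j -> ~~ ltI j i;
  swo_total : forall i j, i != j -> ltI i j || ltI j i;
  swo_least : forall P : I -> Prop, (exists i, P i) ->
    exists2 i, P i & forall j, ltI j i -> ~ P j }.

Lemma strict_well_order_exists : exists ltI : rel I, strict_well_order ltI.
Proof.
have [le le_wo] := well_ordering_principle I.
have le_wo' : wo_chain le predT by move=> A _; apply: le_wo.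
have anti x y : le x y -> le y x -> x = y.
  by move=> xy yx; apply: (wo_chain_antisymmetric le_wo') => //; apply/andP.
exists (fun i j => (i != j) && le i j); split=> [i j /andP[ij leij]|i j ij|P [i Pi]].
- by apply/negP=> /andP[_ /(anti _ _ leij) eij]; rewrite eij eqxx in ij.
- by rewrite ij eq_sym ij; apply: (wo_chainW le_wo').
have [|m [[Pm minm] _]] := le_wo [pred x | `[< P x >]].
  by exists i; apply/asboolP.
exists m; first exact/asboolP.
move=> j /andP[jm lejm] Pj; move/eqP: jm; apply; apply: anti lejm (minm j _).
exact/asboolP.
Qed.

Variable ltI : rel I.
Hypothesis swo : strict_well_order ltI.

(** Transitivity follows from the existence of a least element of the set
    consisting of [i], [j] and [k]. *)
Lemma swo_trans : transitive ltI.
Proof.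
move=> j i k ij jk.
have [|m [->|[->|->]] minm] := swo_least swo (P := fun x => x = i \/ x = j \/ x = k).
- by exists i; left.
- have [eik|/(swo_total swo)/orP[//|ki]] := eqVneq i k.
    by move: ij; rewrite eik => /(swo_asym swo); rewrite jk.
  by case: (minm _ ki); right; right.
- by case: (minm _ ij); left.
- by case: (minm _ jk); right; left.
Qed.

Definition lex s t : bool :=
  `[< exists2 i, (count_mem i s < count_mem i t)%N &
        forall j, ltI j i -> count_mem j s = count_mem j t >].

Lemma lex_word_order : word_order lex.
Proof.
split.
- move=> t s u /asboolP[i lti ei] /asboolP[j ltj ej]; apply/asboolP.
  have [eij|/(swo_total swo)/orP[ij|ji]] := eqVneq i j.
  + exists i => [|k ki]; first by rewrite (leq_trans lti) // ltnW // eij.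
    by rewrite ei // ej // -eij.
  + exists i => [|k ki]; first by rewrite -(ej _ ij).
    by rewrite ei // ej // (swo_trans ki).
  + exists j => [|k kj]; first by rewrite (ei _ ji).
    by rewrite ei ?ej // (swo_trans kj).
- move=> s t /asboolP[i lti _]; apply/negP=> /permP/(_ (pred1 i)) e.
  by rewrite e ltnn in lti.
- move=> s t nst.
  have [|i /eqP nei mini] := swo_least swo
      (P := fun i => count_mem i s <> count_mem i t).
    apply: contrapT => nex; move/negP: nst; apply; apply/allP=> i _ /=.
    by apply/eqP; apply: contrapT => ni; apply: nex; exists i.
  have eqi j : ltI j i -> count_mem j s = count_mem j t.
    by move=> ji; apply: contrapT (mini _ ji).
  have [lti|lti|ei] := ltngtP (count_mem i s) (count_mem i t).
  + by left; apply/asboolP; exists i.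
  + by right; apply/asboolP; exists i => // j /eqi.
  + by rewrite ei eqxx in nei.
- move=> s s' t t' /permP ss' /permP tt' /asboolP[i lti ei].
  apply/asboolP; exists i => [|j /ei]; by rewrite -ss' -tt'.
- move=> u s t /asboolP[i lti ei]; apply/asboolP; exists i => [|j /ei e].
    by rewrite !count_cat ltn_add2l.
  by rewrite !count_cat e.
Qed.

End Lexicographic.

(** * Monomials span the quantum space *)

Section Monomials.
Variables (K : fieldType) (I : choiceType) (q : I -> I -> K).
Implicit Types (i j k : I) (s t : seq I) (u v : Kq q).
Local Notation A := (Kq q).

Definition mon s : A := \prod_(i <- s) kq_var q i.

Lemma mon_cat s t : mon (s ++ t) = mon s * mon t.
Proof. exact: big_cat. Qed.

Lemma mon_cons i s : mon (i :: s) = kq_var q i * mon s.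
Proof. exact: big_cons. Qed.

Lemma mon1 i : mon [:: i] = kq_var q i.
Proof. exact: big_seq1. Qed.

Lemma kq_piD a b : kq_pi q (KqAdd a b) = kq_pi q a + kq_pi q b.
Proof. by rewrite [RHS]kq_addE. Qed.

Lemma kq_piM a b : kq_pi q (KqMul a b) = kq_pi q a * kq_pi q b.
Proof. by rewrite [RHS]kq_mulE. Qed.

Lemma kq_piC c : kq_pi q (KqCst _ c) = c *: (1 : A).
Proof. by rewrite -[LHS]mulr1. Qed.

Lemma kq_varC i j : kq_var q i * kq_var q j = q i j *: (kq_var q j * kq_var q i).
Proof.
rewrite -[LHS]kq_piM -[kq_var q j * _]kq_piM -[RHS]kq_piM.
exact/kq_piP/kq_rel.
Qed.

Definition lincomb (l : seq (K * seq I)) : A := \sum_(p <- l) p.1 *: mon p.2.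

Lemma lincomb_cat l l' : lincomb (l ++ l') = lincomb l + lincomb l'.
Proof. exact: big_cat. Qed.

Definition lcscale c s (l : seq (K * seq I)) := [seq (c * p.1, s ++ p.2) | p <- l].

Lemma lincomb_scale c s l : lincomb (lcscale c s l) = c *: mon s * lincomb l.
Proof.
rewrite /lincomb big_map mulr_sumr; apply: eq_bigr => p _ /=.
by rewrite mon_cat -scalerAl -scalerAr scalerA.
Qed.

Lemma kq_spanned u : exists l, u = lincomb l.
Proof.
elim/kq_ind: u; elim=> [i|c|a [l el] b [m em]|a [l el] b [m em]].
- by exists [:: (1, [:: i])]; rewrite /lincomb big_seq1 /= scale1r mon1.
- by exists [:: (c, [::])]; rewrite /lincomb big_seq1 /= /mon big_nil kq_piC.
- by exists (l ++ m); rewrite kq_piD el em lincomb_cat.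
rewrite kq_piM el em; elim: l {a el} => [|p l [n en]].
  by exists [::]; rewrite /lincomb !big_nil mul0r.
exists (lcscale p.1 p.2 m ++ n).
by rewrite lincomb_cat lincomb_scale -en -mulrDl /lincomb [in LHS]big_cons.
Qed.

Hypothesis q_neq0 : forall i j, q i j != 0.

(** The relations reorder the letters of a word at the cost of nonzero
    scalars only. *)
Lemma mon_perm s t : perm_eq s t -> exists2 c, c != 0 & mon s = c *: mon t.
Proof.
have mid i r : forall t1, exists2 c, c != 0 &
    mon (i :: t1 ++ r) = c *: mon (t1 ++ i :: r).
  elim=> [|j t1 [c c0 e]]; first by exists 1; rewrite ?oner_eq0 // scale1r.
  exists (q i j * c); first by rewrite mulf_neq0.
  rewrite /= [in RHS]mon_cons -scalerA (scalerAr c) -e !mon_cons.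
  by rewrite !mulrA kq_varC -scalerAl.
elim: s t => [|i s IHs] t.
  by rewrite perm_sym => /perm_nilP->; exists 1; rewrite ?oner_eq0 // scale1r.
move=> st; have it : i \in t by rewrite -(perm_mem st) mem_head.
case/splitPr: it st => t1 t2; rewrite -[i :: s]cat1s.
rewrite perm_sym -[i :: t2]cat1s perm_catCA perm_cat2l perm_sym.
move=> /IHs[c c0 e]; have [d d0 e'] := mid i t2 t1.
exists (c * d); first by rewrite mulf_neq0.
by rewrite -scalerA -e' [LHS]mon_cons e [in RHS]mon_cons scalerAr.
Qed.

End Monomials.
(** * Coefficients of monomials *)

Section Representation.
Variables (K : fieldType) (I : choiceType) (q : I -> I -> K).
Hypotheses (q_neq0 : forall i j, q i j != 0) (q_diag : forall i, q i i = 1).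
Hypothesis q_inv : forall i j, q i j = (q j i)^-1.
Variable ltI : rel I.
Hypothesis swo : strict_well_order ltI.
Implicit Types (i j k : I) (r s t : seq I) (u v : Kq q).
Implicit Types (a b : kq_term K I) (f g : seq I -> K).

Definition perm_inv f := forall s t, perm_eq s t -> f s = f t.

(** The scalar produced when [x_i], multiplied on the right of the letters of
    [s] sorted in decreasing order, moves left past all the smaller ones. *)
Definition chi i s : K := \prod_(j <- s | ltI j i) q j i.

Lemma chi_neq0 i s : chi i s != 0.
Proof. by rewrite prodf_seq_neq0; apply/allP => j _; apply/implyP. Qed.

(** This cocycle identity is what makes the operators [ev] satisfy
    [x_i x_j = q_ij x_j x_i]. *)
Lemma chi_comm i j s :
  chi i s * chi j (i :: s) = q i j * (chi j s * chi i (j :: s)).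
Proof.
rewrite /chi !big_cons; have [<-|ij] := eqVneq i j; first by rewrite q_diag !mul1r.
have /orP[lij|lji] := swo_total swo ij.
  by rewrite lij (negbTE (swo_asym swo lij)) mulrCA; congr (_ * _); apply: mulrC.
rewrite lji (negbTE (swo_asym swo lji)) mulrC [q i j]q_inv.
by rewrite [in RHS](mulrCA _ (q j i)) mulKf.
Qed.

(** The transpose of right multiplication on the basis of decreasingly sorted
    monomials, which is a left action: [x_i] sends [f] to [s |-> chi i s * f (i :: s)].  Acting on all functions
    on multisets, rather than on finitely supported ones, spares any finiteness
    bookkeeping. *)
Fixpoint ev a f s : K := match a with
  | KqVar i => chi i s * f (i :: s)
  | KqCst c => c * f s
  | KqAdd a b => ev a f s + ev b f s
  | KqMul a b => ev a (ev b f) s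
  end.

Lemma ev_perm_inv a f : perm_inv f -> perm_inv (ev a f).
Proof.
elim: a f => [i|c|a IHa b IHb|a IHa b IHb] f pf s t st /=.
- by rewrite /chi (perm_big _ st) (pf (i :: s) (i :: t)) // perm_cons.
- by rewrite (pf s t).
- by rewrite (IHa _ pf s t) // (IHb _ pf s t).
- by apply: IHa st; apply: IHb.
Qed.

Lemma evD a f g s : ev a (fun r => f r + g r) s = ev a f s + ev a g s.
Proof.
elim: a f g s => [i|c|a IHa b IHb|a IHa b IHb] f g s /=.
- by rewrite mulrDr.
- by rewrite mulrDr.
- by rewrite IHa IHb addrACA.
- by rewrite -IHa; congr ev; apply/funext => r; rewrite IHb.
Qed.

Lemma evZ a c f s : ev a (fun r => c * f r) s = c * ev a f s.
Proof.
elim: a f s => [i|d|a IHa b IHb|a IHa b IHb] f s /=.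
- by rewrite mulrCA.
- by rewrite mulrCA.
- by rewrite IHa IHb mulrDr.
- by rewrite -IHa; congr ev; apply/funext => r; rewrite IHb.
Qed.

(** The operators respect the defining relations.  Invariance of [f] is needed
    for the commutation relation, where [x_i x_j] evaluates [f] at
    [j :: i :: s] and [x_j x_i] at [i :: j :: s]. *)
Lemma ev_eq a b f : kq_eq q a b -> perm_inv f -> ev a f = ev b f.
Proof.
move=> ab; elim: ab f => {a b} /=.
- by [].
- by move=> a b _ IH f pf; rewrite IH.
- by move=> a b c _ IH _ IH' f pf; rewrite IH ?IH'.
- by move=> a a' b b' _ IH _ IH' f pf; apply/funext=> s /=; rewrite IH ?IH'.
- move=> a a' b b' _ IH _ IH' f pf; apply/funext=> s /=.
  by rewrite IH' // IH //; apply: ev_perm_inv.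
- by move=> a b c f pf; apply/funext=> s /=; rewrite addrA.
- by move=> a b f pf; apply/funext=> s /=; rewrite addrC.
- by move=> a f pf; apply/funext=> s /=; rewrite mul0r add0r.
- by move=> a f pf; apply/funext=> s /=; rewrite mulN1r addNr mul0r.
- by [].
- by move=> a f pf; apply/funext=> s /=; rewrite mul1r.
- by [].
- by move=> a b c f pf; apply/funext=> s /=; rewrite evD.
- by move=> a b f pf; apply/funext=> s /=; rewrite mulrDl.
- by move=> a b f pf; apply/funext=> s /=; rewrite mulrA.
- by move=> c a f pf; apply/funext=> s /=; rewrite evZ.
- move=> i j f pf; apply/funext=> s /=.
  rewrite !mulrA -[chi i s * _]/(chi i s * chi j (i :: s)) chi_comm !mulrA.
  by congr (_ * _); apply: pf; apply: permEl (perm_catCA [:: j] [:: i] s).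
Qed.

Definition act u f := ev (kq_repr u) f.

Lemma act_pi a f : perm_inv f -> act (kq_pi q a) f = ev a f.
Proof. by move=> pf; apply: ev_eq pf; apply: kq_repr_pi. Qed.

(** The coefficient in [u = 1 * u] of the monomial whose letters are those of
    [s], sorted in decreasing order. *)
Definition mcoef s u : K := act u (fun t => (perm_eq s t)%:R) [::].

Lemma perm_inv_indic s : perm_inv (fun t => (perm_eq s t)%:R).
Proof. by move=> t t' /permPr->. Qed.
Hint Resolve perm_inv_indic : core.

Lemma mcoef_perm s t u : perm_eq s t -> mcoef s u = mcoef t u.
Proof.
by move=> st; congr act; apply/funext => r; rewrite (permPl st).
Qed.

Lemma mcoefD s u v : mcoef s (u + v) = mcoef s u + mcoef s v.
Proof.
elim/kq_ind: u => a; elim/kq_ind: v => b.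
by rewrite -kq_piD /mcoef !act_pi.
Qed.

Lemma mcoefZ s c u : mcoef s (c *: u) = c * mcoef s u.
Proof.
elim/kq_ind: u => a.
have -> : c *: kq_pi q a = kq_pi q (KqMul (KqCst _ c) a) by rewrite kq_piM.
by rewrite /mcoef !act_pi.
Qed.

Lemma mcoef0 s : mcoef s 0 = 0.
Proof. by rewrite -(scale0r 0) mcoefZ mul0r. Qed.

(** A monomial acts by translation, up to a nonzero scalar. *)
Lemma act_mon s f r : perm_inv f ->
  exists2 c, c != 0 & act (mon q s) f r = c * f (catrev s r).
Proof.
move=> pf; elim: s r => [|i s IHs] r.
  exists 1; first exact: oner_neq0.
  by rewrite /mon big_nil [act _ _]act_pi.
have [c c0 e] := IHs (i :: r).
exists (chi i r * c); first by rewrite mulf_neq0 ?chi_neq0.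
rewrite -mulrA -e mon_cons -[mon q s]kq_reprK -[kq_var _ _ * _]kq_piM.
by rewrite !act_pi.
Qed.

Lemma mcoef_mon s t :
  exists2 c, c != 0 & mcoef t (mon q s) = c * (perm_eq t s)%:R.
Proof.
have [c c0 e] := act_mon s [::] (@perm_inv_indic t).
by exists c; rewrite // /mcoef e -[catrev s _]/(rev s) perm_sym perm_rev perm_sym.
Qed.

Lemma mcoef_mon_neq0 s t : mcoef t (mon q s) != 0 -> perm_eq s t.
Proof.
have [c c0 ->] := mcoef_mon s t; rewrite perm_sym.
by case: perm_eq; rewrite ?mulr0 ?eqxx.
Qed.

Lemma mcoef_mon_id s : mcoef s (mon q s) != 0.
Proof. by have [c c0 ->] := mcoef_mon s s; rewrite perm_refl mulr1. Qed.

Lemma mcoef_lincomb_neq0 s l : mcoef s (lincomb q l) != 0 ->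
  exists2 p, p \in l & perm_eq p.2 s.
Proof.
elim: l => [|p l IHl]; first by rewrite /lincomb big_nil mcoef0 eqxx.
rewrite /lincomb big_cons mcoefD mcoefZ => h.
have [e|/mcoef_mon_neq0 ps] := eqVneq (mcoef s (mon q p.2)) 0.
  rewrite e mulr0 add0r in h; have [p' p'l ?] := IHl h.
  by exists p'; rewrite // inE p'l orbT.
by exists p; rewrite ?mem_head.
Qed.

(** * Leading monomials *)

Section Leading.
Variable lt : rel (seq I).
Hypothesis wo : word_order lt.

Definition below s v : Prop :=
  exists2 l, v = lincomb q l & forall p, p \in l -> lt p.2 s.

Definition leading u s : Prop :=
  exists c, c != 0 /\ below s (u - c *: mon q s).

Lemma below0 s : below s 0.
Proof. by exists [::] => //; rewrite /lincomb big_nil. Qed.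

Lemma belowD s u v : below s u -> below s v -> below s (u + v).
Proof.
move=> [l -> hl] [m -> hm]; exists (l ++ m); first by rewrite lincomb_cat.
by move=> p; rewrite mem_cat => /orP[/hl|/hm].
Qed.

Lemma below_mulmon s c t v : below s v -> below (t ++ s) (c *: mon q t * v).
Proof.
move=> [l -> hl]; exists (lcscale c t l); first by rewrite lincomb_scale.
by move=> _ /mapP[p /hl ? ->]; apply: (wlt_cat2l wo).
Qed.

Lemma below_leading u v s t : below s u -> leading v t -> below (s ++ t) (u * v).
Proof.
move=> [l -> hl] [c [_ [m em hm]]]; elim: l hl => [|p l IHl] hl.
  by rewrite /lincomb big_nil mul0r; apply: below0.
rewrite /lincomb big_cons mulrDl; apply: belowD; last first.
  by apply: IHl => p' p'l; apply: hl; rewrite inE p'l orbT.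
have ps : lt p.2 s by apply: hl; rewrite mem_head.
exists (lcscale p.1 p.2 ((c, t) :: m)).
  by rewrite lincomb_scale /lincomb big_cons -[bigop _ _ _]/(lincomb q m) -em addrC subrK.
move=> _ /mapP[p' + ->] /=; rewrite inE => /predU1P[->|/hm p't] /=.
  exact: wlt_cat2r.
by apply: (wlt_trans wo) (wlt_cat2l wo _ p't) (wlt_cat2r _ wo ps).
Qed.

Lemma leading_mul u v s t : leading u s -> leading v t -> leading (u * v) (s ++ t).
Proof.
move=> lu lv; have [c [c0 bu]] := lu; have [d [d0 bv]] := lv.
exists (c * d); split; first by rewrite mulf_neq0.
have -> : u * v - (c * d) *: mon q (s ++ t) =
    (u - c *: mon q s) * v + c *: mon q s * (v - d *: mon q t).
  rewrite mulrBl mulrBr addrA subrK mon_cat.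
  by rewrite -[in RHS]scalerAl -[in RHS]scalerAr scalerA.
by apply: belowD; [apply: below_leading|apply: below_mulmon].
Qed.

Lemma mcoef_below s t u : below s u -> mcoef t u != 0 -> lt t s.
Proof.
move=> [l -> hl] /mcoef_lincomb_neq0[p /hl ps pt].
exact: (wlt_perm wo) pt (perm_refl s) ps.
Qed.

Lemma leading_coef u s : leading u s -> mcoef s u != 0.
Proof.
move=> [c [c0 bu]]; rewrite -(subrK (c *: mon q s) u) mcoefD mcoefZ.
suff -> : mcoef s (u - c *: mon q s) = 0 by rewrite add0r mulf_neq0 ?mcoef_mon_id.
apply/eqP; apply/negPn/negP => /(mcoef_below bu) /(wlt_nperm wo).
by rewrite perm_refl.
Qed.

Lemma leading_max u s t : leading u s -> mcoef t u != 0 -> lt t s \/ perm_eq t s.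
Proof.
move=> [c [c0 bu]]; rewrite -(subrK (c *: mon q s) u) mcoefD mcoefZ => h.
have [e|/mcoef_mon_neq0] := eqVneq (mcoef t (mon q s)) 0; last first.
  by rewrite perm_sym; right.
by rewrite e mulr0 addr0 in h; left; apply: mcoef_below h.
Qed.

Lemma leading_uniq u s t : leading u s -> leading u t -> perm_eq s t.
Proof.
move=> us ut; have [ts|] := leading_max us (leading_coef ut); last by rewrite perm_sym.
have [st|//] := leading_max ut (leading_coef us).
by have := wlt_nperm wo (wlt_trans wo st ts); rewrite perm_refl.
Qed.

Lemma leading_neq0 u s : leading u s -> u != 0.
Proof. by move/leading_coef; apply: contraNneq => ->; rewrite mcoef0. Qed.

(** Among the words of an expression of [u], take a maximal one [m] and collect
    all the terms that are permutations of [m]: either their sum is nonzero,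
    and [m] is leading, or it vanishes, and a shorter expression of [u] is
    left. *)
Lemma leading_exists u : u != 0 -> exists s, leading u s.
Proof.
have [l] := kq_spanned u; elim: (size l) {-2}l (leqnn (size l)) u => {l}[|n IHn] l.
  rewrite leqn0 => /nilP -> u ->; by rewrite /lincomb big_nil eqxx.
case: l => [|p l] sl u eu; first by apply: (IHn [::]).
have [m ml maxm] := word_max p.2 [seq p.2 | p <- l] wo.
set L := p :: l in sl eu *; rewrite -[_ :: _]/(map snd L) in ml maxm.
pose Lm := [seq p <- L | lt p.2 m].
have below_m : below m (lincomb q Lm).
  by exists Lm => // p'; rewrite mem_filter => /andP[].
(* the terms of [L] outside [Lm] are those proportional to [mon q m] *)
have [c ec] : exists c, u = c *: mon q m + lincomb q Lm.
  rewrite eu {below_m sl ml eu}/Lm; elim: {p l}L maxm => [|p l IHl] maxl.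
    by exists 0; rewrite scale0r add0r.
  have [|c] := IHl; first by move=> t tl; apply: maxl; rewrite inE tl orbT.
  rewrite /lincomb big_cons => ->.
  rewrite [in [seq _ <- _ :: _ | _]]/= ; case: (maxl p.2 (mem_head _ _)) => pm.
    by exists c; rewrite pm big_cons addrCA.
  have -> : lt p.2 m = false by apply/negP => /(wlt_nperm wo); rewrite pm.
  have [d _ ->] := mon_perm q_neq0 pm.
  by exists (p.1 * d + c); rewrite scalerDl scalerA addrA.
have [c0|c0 u0] := eqVneq c 0; last first.
  by exists m, c; rewrite c0 ec addrC addKr.
rewrite c0 scale0r add0r in ec; apply: (IHn Lm) => //.
rewrite -ltnS (leq_trans _ sl) // size_filter.
rewrite -(count_predC (fun p => lt p.2 m) L) -[X in (X < _)%N]addn0 ltn_add2l -has_count.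
have /mapP[p' p'L em] := ml.
apply/hasP; exists p' => //=; apply/negP => /(wlt_nperm wo).
by rewrite em perm_refl.
Qed.

(** Multidegrees of leading monomials add, and [sb + sc = sa + sd] together with
    [sb + [:: i] + sc = sa + s + sd] gives [s = [:: i]]. *)
Lemma leading_var (b c a d y : Kq q) i s : b != 0 -> c != 0 -> a != 0 -> d != 0 ->
  b * c = a * d -> b * kq_var q i * c = a * y * d -> leading y s ->
  perm_eq s [:: i].
Proof.
move=> /leading_exists[sb lb] /leading_exists[sc lc].
move=> /leading_exists[sa la] /leading_exists[sd ld] bc bic ly.
have lx : leading (kq_var q i) [:: i].
  by exists 1; rewrite oner_neq0 mon1 scale1r subrr; split=> //; apply: below0.
have /permP p1 : perm_eq (sb ++ sc) (sa ++ sd).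
  by apply: (@leading_uniq (b * c)); [|rewrite bc]; apply: leading_mul.
have /permP p2 : perm_eq ((sb ++ [:: i]) ++ sc) ((sa ++ s) ++ sd).
  apply: (@leading_uniq (b * kq_var q i * c)); [|rewrite bic];
    by do ?apply: leading_mul.
by apply/permP => P; have := p1 P; have := p2 P; rewrite !count_cat /=; lia.
Qed.

End Leading.

(** * The quantum space is a domain *)

Lemma kq_mulf_neq0 u v : u != 0 -> v != 0 -> u * v != 0.
Proof.
have wo := lex_word_order swo.
move=> /(leading_exists wo)[s us] /(leading_exists wo)[t vt].
exact: (leading_neq0 wo (leading_mul wo us vt)).
Qed.

(** The difference of two elements with the same coefficients has no leading
    monomial. *)
Lemma mcoef_inj u v : (forall s, mcoef s u = mcoef s v) -> u = v.
Proof.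
move=> uv; apply/eqP; rewrite -subr_eq0; apply/negPn/negP.
have wo := lex_word_order swo.
move=> /(leading_exists wo)[t /(leading_coef wo)].
by rewrite -scaleN1r mcoefD mcoefZ uv mulN1r subrr eqxx.
Qed.

(** Both the leading and the trailing monomial of [y] are [x_i], hence [y] has
    no other monomial. *)
Lemma kq_var_twist (b c a d y : Kq q) i : b != 0 -> c != 0 -> a != 0 -> d != 0 ->
  b * c = a * d -> b * kq_var q i * c = a * y * d ->
  exists2 alpha, alpha != 0 & y = alpha *: kq_var q i.
Proof.
move=> b0 c0 a0 d0 bc bic.
have x0 : kq_var q i != 0.
  by rewrite -mon1; apply: contraNneq (mcoef_mon_id [:: i]) => ->; rewrite mcoef0.
have y0 : y != 0.
  have := kq_mulf_neq0 (kq_mulf_neq0 b0 x0) c0.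
  by apply: contraNneq => y0; rewrite bic y0 mulr0 mul0r.
pose lt := lex ltI.
have wo : word_order lt := lex_word_order swo.
have wo' := word_order_flip wo.
have onlyi t : mcoef t y != 0 -> perm_eq t [:: i].
  have [s ys] := leading_exists wo y0; have [s' ys'] := leading_exists wo' y0.
  have si := leading_var wo b0 c0 a0 d0 bc bic ys.
  have s'i := leading_var wo' b0 c0 a0 d0 bc bic ys'.
  move=> yt; case: (leading_max wo ys yt) => [ts|]; last by move/perm_trans->.
  case: (leading_max wo' ys' yt) => [s't|]; last by move/perm_trans->.
  have := wlt_nperm wo (wlt_trans wo s't ts).
  by rewrite (perm_trans s'i) // perm_sym.
have k0 : mcoef [:: i] (mon q [:: i]) != 0 := mcoef_mon_id [:: i].
exists (mcoef [:: i] y / mcoef [:: i] (mon q [:: i])).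
  have [s ys] := leading_exists wo y0; rewrite mulf_neq0 ?invr_eq0 //.
  have ns := leading_coef wo ys.
  by rewrite -(mcoef_perm y (onlyi _ ns)).
rewrite -mon1; apply: mcoef_inj => t; rewrite mcoefZ.
have [ti|nti] := boolP (perm_eq t [:: i]).
  by rewrite !(mcoef_perm _ ti) divfK.
have [-> ->] : mcoef t y = 0 /\ mcoef t (mon q [:: i]) = 0; last by rewrite mulr0.
split; apply/eqP; apply: contraNT nti; first exact: onlyi.
by move=> /mcoef_mon_neq0; rewrite perm_sym.
Qed.

End Representation.
(** * Symbols in a filtered algebra whose graded algebra is a domain *)

Lemma scale_polyXnM (R : nzRingType) (x y : R) m n :
  (x *: 'X^m) * (y *: 'X^n) = (x * y) *: 'X^(m + n).
Proof.
rewrite -!mul_polyC polyCM exprD -!mulrA; congr (_ * _).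
by rewrite mulrA (commr_polyXn y%:P m) mulrA.
Qed.

Section Symbols.
Variables (K : fieldType) (R : algType K) (F : filtration R).
Implicit Types (x y : R) (m n : nat).

Lemma fil_le m n x : (m <= n)%N -> F m x -> F n x.
Proof.
move=> /subnKC<-; elim: (n - m)%N => [|k IHk] Fx; first by rewrite addn0.
by rewrite addnS; apply/filS/IHk.
Qed.

Lemma degree_le n x : F n x -> (degree F x <= n)%N.
Proof. by move=> Fx; rewrite /degree; case: ex_minnP => m _; apply; apply/asboolP. Qed.

Lemma degree_eq n x : F n x -> ~ fil_pred F n x -> degree F x = n.
Proof.
move=> Fx nFx; apply/eqP; rewrite eqn_leq degree_le //= leqNgt; apply/negP.
case: n nFx {Fx} => // n nFx; rewrite ltnS => le_n.
by apply: nFx; apply: fil_le le_n _; apply: degreeP.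
Qed.

Lemma fil_pred_degree x : x != 0 -> ~ fil_pred F (degree F x) x.
Proof.
case e: (degree F x) => [|n] /= x0; first exact/eqP.
by move=> /degree_le; rewrite e ltnn.
Qed.

(** The component of degree [n] of [gr F] is [R_n / R_(n-1)]. *)
Lemma gr_pi_mono_eq (p r : rees F) n x y :
  rees_val p = x *: 'X^n -> rees_val r = y *: 'X^n ->
  gr_pi p = gr_pi r <-> fil_pred F n (x - y).
Proof.
move=> ep er; split=> [/gr_piP/(_ n)|h].
  by rewrite ep er !coefZ coefXn eqxx !mulr1.
apply/gr_piP => k; rewrite ep er !coefZ coefXn.
by case: eqP => [->|_]; rewrite ?mulr1 // !mulr0 subrr; apply: fil_pred0.
Qed.

Lemma gr_symbol_neq0 x : x != 0 -> gr_symbol F x != 0.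
Proof.
move=> x0; apply/eqP => h; apply: (fil_pred_degree x0); rewrite -[X in fil_pred _ _ X]subr0.
by apply: (gr_pi_mono_eq _ _).1 h; rewrite ?scale0r.
Qed.

Lemma gr_symbol_scale x y (c : K) : degree F x = degree F y ->
  gr_symbol F x = c *: gr_symbol F y -> fil_pred F (degree F y) (x - c *: y).
Proof.
move=> dxy; rewrite [X in _ = X -> _]gr_mulE.
move=> h; apply: (gr_pi_mono_eq _ _).1 h; first by rewrite /= dxy.
by rewrite /= mul_polyC scalerA -scalerAl mul1r.
Qed.

Hypothesis gr_domain : forall u v : gr F, u != 0 -> v != 0 -> u * v != 0.

(** The product of the symbols is the class of [x * y] in degree
    [degree x + degree y]; it is nonzero, so the degree does not drop. *)
Lemma fil_pred_mul_degree x y : x != 0 -> y != 0 ->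
  ~ fil_pred F (degree F x + degree F y) (x * y).
Proof.
move=> /gr_symbol_neq0 x0 /gr_symbol_neq0 y0 h.
have /eqP := gr_domain x0 y0; apply; rewrite [LHS]gr_mulE.
apply/(@gr_pi_mono_eq _ _ (degree F x + degree F y) (x * y) 0); rewrite ?subr0 //=.
- exact: scale_polyXnM.
- by rewrite scale0r.
Qed.

Lemma filtered_mulf_neq0 x y : x != 0 -> y != 0 -> x * y != 0.
Proof.
move=> x0 y0; apply/eqP => xy0; apply: (fil_pred_mul_degree x0 y0).
by rewrite xy0; apply: fil_pred0.
Qed.

Lemma degreeM x y : x != 0 -> y != 0 ->
  degree F (x * y) = (degree F x + degree F y)%N.
Proof.
move=> x0 y0; apply: degree_eq; last exact: fil_pred_mul_degree.
by apply: filM; apply: degreeP.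
Qed.

Lemma gr_symbolM x y : x != 0 -> y != 0 ->
  gr_symbol F (x * y) = gr_symbol F x * gr_symbol F y.
Proof.
move=> x0 y0; rewrite [RHS]gr_mulE.
apply/(@gr_pi_mono_eq _ _ (degree F x + degree F y) (x * y) (x * y)).
- by rewrite /= degreeM.
- exact: scale_polyXnM.
- by rewrite subrr; apply: fil_pred0.
Qed.
End Symbols.

(** * X-inner maps of a domain *)

Section DomainXInner.
Variable R : pzRingType.
Hypotheses (R1 : (1 : R) <> 0).
Hypothesis Rdom : forall x y : R, x != 0 -> y != 0 -> x * y != 0.

Lemma domain_prime : prime_ring R.
Proof.
split=> // A B [_ [a Aa /eqP a0]] [_ [b Bb /eqP b0]].
by exists a, b; split=> //; apply/eqP/Rdom.
Qed.

(** A homomorphism that kills [J] agrees with zero on the nonzero ideal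
    [J `&` mdom f]. *)
Lemma ideal_mul_mart_neq0 (primeR : prime_ring R) (w : martindale primeR) (J : set R) :
  w != 0 -> nonzero_ideal J -> exists2 a, J a & mart_of primeR a * w != 0.
Proof.
elim/mart_ind: w => f f0 nJ; apply: contrapT => h.
move/eqP: f0; apply; apply/mart_piP.
exists (J `&` mdom f)%classic; split=> //.
- exact: nonzero_idealI primeR _ _ nJ (mdomP f).

- move=> x [Jx fx]; rewrite /= mulr0.
  apply: (@mart_of_inj _ primeR); rewrite -mart_ofM // raddf0.
  by apply/eqP/negPn/negP => xf; apply: h; exists x.
Qed.

(** With [b := a w] and [d := w c], the relation [sigma r * w = w * r], once
    multiplied by [a] on the left and by [c] on the right, takes place inside
    [R].  Here [d] is nonzero because [a * d = b * c], the identity at [r = 1]. *)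
Lemma X_inner_twist (primeR : prime_ring R) (s : R -> R) : X_inner primeR s ->
  exists a b c d : R, [/\ a != 0, b != 0, c != 0, d != 0 &
    forall r, b * r * c = a * s r * d].
Proof.
move=> [w [[[J [nJ Jw wJ]] _] w0 sw]].
have [a Ja aw0] := ideal_mul_mart_neq0 w0 nJ.
have [b ab] := Jw a Ja.
have [_ [c Jc /eqP c0]] := nJ.
have [d cd] := wJ c Jc.
have E r : b * r * c = a * s r * d.
  apply: (@mart_of_inj _ primeR); rewrite !rmorphM /= -ab -cd.
  by rewrite -!mulrA; congr (_ * _); rewrite !mulrA sw.
have b0 : b != 0 by apply: contraNneq aw0 => b0; rewrite ab b0 raddf0.
have a0 : a != 0 by apply: contraNneq aw0 => ->; rewrite raddf0 mul0r.
have bc0 : b * c != 0 by apply: Rdom.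
exists a, b, c, d; split=> //; apply: contraNneq bc0 => d0.
by rewrite -[b]mulr1 E d0 mulr0.
Qed.
End DomainXInner.

Theorem theorem2p3
    (K : fieldType) (R : algType K) (F : filtration R)
    (I : choiceType) (q : I -> I -> K)
    (q_neq0 : forall i j, q i j != 0)
    (q_diag : forall i, q i i = 1)
    (q_inv : forall i j, q i j = (q j i)^-1)
    (phi : {lrmorphism Kq q -> gr F}) (phi_bij : bijective phi) :
  prime_ring R /\
  forall (primeR : prime_ring R) (sigma : {rmorphism R -> R}),
    bijective sigma -> X_inner primeR sigma ->
    preserves_filtration F sigma /\
    forall x : R, x != 0 -> (exists i : I, gr_symbol F x = phi (kq_var q i)) ->
      exists alpha : K,
        alpha != 0 /\ fil_pred F (degree F x) (sigma x - alpha *: x).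
Proof.
have [ltI swo] := strict_well_order_exists I.
have [psi phiK psiK] := phi_bij.
have phi_inj := can_inj phiK.
have psi0 (u : gr F) : u != 0 -> psi u != 0.
  by apply: contraNneq => pu0; rewrite -(psiK u) pu0 raddf0.
have gr_dom (u v : gr F) : u != 0 -> v != 0 -> u * v != 0.
  move=> /psi0 u0 /psi0 v0; rewrite -(psiK u) -(psiK v) -rmorphM.
  rewrite -(raddf0 phi) (inj_eq phi_inj).
  exact: (kq_mulf_neq0 q_neq0 q_diag q_inv swo).
have R_dom := filtered_mulf_neq0 gr_dom.
have R1 : (1 : R) <> 0 by apply/eqP; exact: oner_neq0.
split; first exact: domain_prime.
move=> primeR sigma sigma_bij /(X_inner_twist R_dom)[a [b [c [d]]]].
move=> [a0 b0 c0 d0 E].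
have bc : b * c = a * d by have := E 1; rewrite rmorph1 !mulr1.
have s0 (r : R) : r != 0 -> sigma r != 0.
  by move=> r0; rewrite -(rmorph0 sigma) (inj_eq (bij_inj sigma_bij)).
have presF : preserves_filtration F sigma.
  move=> r r0; have := congr1 (degree F) (E r); have := congr1 (degree F) bc.
  by rewrite !(degreeM gr_dom) ?R_dom ?s0 //; lia.
split=> // x x0 [i xi].
(* [S r] is the symbol of [r], read in the quantum space *)
pose S r := psi (gr_symbol F r).
have S0 (r : R) : r != 0 -> S r != 0 by move=> r0; apply/psi0/gr_symbol_neq0.
have SM (r t : R) : r != 0 -> t != 0 -> S (r * t) = S r * S t.
  move=> r0 t0; apply: phi_inj; rewrite rmorphM /S psiK (gr_symbolM gr_dom) //.
  by congr (_ * _); apply/esym/psiK.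
have Sx : S x = kq_var q i by rewrite /S xi phiK.
have Sbc : S b * S c = S a * S d by rewrite -!SM ?bc.
have Sbxc : S b * kq_var q i * S c = S a * S (sigma x) * S d.
  by rewrite -Sx -!SM ?R_dom ?s0 ?E.
have [alpha alpha0 Ssx] := kq_var_twist q_neq0 q_diag q_inv swo
  (S0 _ b0) (S0 _ c0) (S0 _ a0) (S0 _ d0) Sbc Sbxc.
exists alpha; split=> //.
apply: gr_symbol_scale; first exact: presF.
by rewrite -(psiK (gr_symbol F (sigma x))) [psi _]Ssx linearZ xi.
Qed.
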